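(* Fix a stratum $\mathcal H(a_1,a_2,-b_1,\dots,-b_p)$ of meromorphic differentials on $\mathbb{CP}^1$ with two zeros and $p\ge2$ poles, and let $\mathcal B=\mathcal R_p\setminus\mathcal A_p$. For any $\lambda\in\mathcal B$, any loop $\alpha$ in $\mathcal B$ based at $\lambda$, and any relative homology class $[\gamma]\in H_1(\overline{\mathcal F}_\lambda\setminus P_{\omega_\lambda},Z_{\omega_\lambda},\mathbb Z)$, we have $$\Psi(\lambda,T_\alpha[\gamma])=\Psi(\lambda,[\gamma]),$$ where $T_\alpha$ is the monodromy automorphism of the Gauss–Manin connection along $\alpha$ and $\Psi$ is the period central charge.
   Context: $\mathcal H(\mu)=\mathcal H(a_1,a_2,-b_1,\dots,-b_p)$ ($a_i,b_j$ positive integers, $a_1+a_2-\sum b_j=-2$) is the moduli space of meromorphic one-forms on $\mathbb{CP}^1$ with labeled zeros $z_1,z_2$ of orders $a_1,a_2$ and labeled poles of orders $b_1,\dots,b_p$, up to biholomorphism. Residue at a pole means the period over a positively oriented loop. $\mathcal R_p=\{\lambda\in\mathbb C^p:\sum\lambda_j=0\}$; $\mathcal A_p$ is the union of the hyperplanes $\{\sum_{i\in I}\lambda_i=0\}$ over nonempty proper $I\subset\{1,\dots,p\}$. $\mathcal F_\lambda$ is the locus of differentials with residue $\lambda_j$ at the $j$-th pole for all $j$; on it $\omega_\lambda=d(\int_\gamma\omega)$ for any path $\gamma$ from $z_1$ to $z_2$ avoiding the poles. $\overline{\mathcal F}_\lambda$ is the closure of (the image of) $\mathcal F_\lambda$ in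 the multi-scale compactification (Bainbridge–Chen–Gendron–Grushevsky–Möller) of $\mathcal H(\mu)/\mathbb C^*$; for $\lambda\in\mathcal B$ it is a compact, possibly disconnected, Riemann surface on which $\omega_\lambda$ extends meromorphically, with zero set $Z_{\omega_\lambda}$ and pole set $P_{\omega_\lambda}$, and the $(\overline{\mathcal F}_\lambda, Z_{\omega_\lambda}, P_{\omega_\lambda})$ form a locally trivial family over $\mathcal B$. $\mathcal E\to\mathcal B$ is the vector bundle with fiber $\mathcal E_\lambda=\mathbb C\otimes H_1(\overline{\mathcal F}_\lambda\setminus P_{\omega_\lambda},Z_{\omega_\lambda},\mathbb Z)$, and the Gauss–Manin connection is the flat connection for which the integral classes are locally constant; for a loop $\alpha$ based at $\lambda$, $T_\alpha$ is the resulting automorphism of $\mathcal E_\lambda$ (parallel transport along $\alpha$). $L^\vee\subset(\mathcal R_p)^*$ is the lattice generated by the linear forms $\lambda\mapsto\sum_{j\in J}\lambda_j$, $J\subset\{1,\dots,p\}$. For an integral class $[\gamma]$ at $\lambda$, extended to nearby $\lambda'$ by the Gauss–Manin connection, the period $\int_{[\gamma]}\omega_{\lambda'}$ depends on $\lambda'$ as an element $w\in L^\vee$, i.e. $\int_{[\gamma]}\omega_{\lambda'}=w(\lambda')$ for $\lambda'$ near $\lambda$. The period central charge is the bundle morphism $\Psi:\mathcal E\to\mathcal B\times(\mathcal R_p)^*$ given on integral classes by $\Psi(\lambda,[\gamma])=(\lambda,w)$ and extended linearly. *)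

(* Defs.v *)
From HB Require Import structures.
From mathcomp Require Import all_boot all_order all_algebra.
From mathcomp Require Import all_classical all_reals all_analysis.
From mathcomp Require Import complex.

Set Implicit Arguments.
Unset Strict Implicit.
Unset Printing Implicit Defensive.

Import Order.TTheory GRing.Theory Num.Theory.
Import numFieldNormedType.Exports.

Local Open Scope classical_set_scope.
Local Open Scope ring_scope.

(* The complex numbers over [R]; the topology, the normed module and the
   vector space structures of [R[i]] live on the alias [R[i]^o]. *)
Notation cplx R := (R[i]^o).

Section ComplexAnalysis.
Context {R : realType}.
Local Notation C := (cplx R).
Implicit Types (h : C -> C) (z : C).

Definition cintegral01 (g : R -> C) : C :=
  Complex (\int[lebesgue_measure]_(t in `[0, 1]) complex.Re (g t))
          (\int[lebesgue_measure]_(t in `[0, 1]) complex.Im (g t)).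

Definition velocity (gamma : R -> C) (t : R) : C :=
  Complex (derive1 (fun s => complex.Re (gamma s)) t)
          (derive1 (fun s => complex.Im (gamma s)) t).

Definition C1_path (gamma : R -> C) : Prop :=
  (forall t, derivable (fun s => complex.Re (gamma s)) t 1 /\
             derivable (fun s => complex.Im (gamma s)) t 1) /\
  continuous (velocity gamma).

Definition path_integral h (gamma : R -> C) : C :=
  cintegral01 (fun t => h (gamma t) * velocity gamma t).

Definition circle (z : C) (r : R) (t : R) : C :=
  z + Complex (r * cos (2 * pi * t)) (r * sin (2 * pi * t)).

Definition holomorphic_at h z : Prop :=
  \forall w \near z, derivable h w (1 : C).

Definition pole_at h z : Prop :=
  exists n : nat, exists g : C -> C,
    [/\ (0 < n)%N, holomorphic_at g z, g z != 0 &
        \forall w \near z^', h w = g w / (w - z) ^+ n].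

Definition zero_at h z : Prop := holomorphic_at h z /\ h z = 0.

End ComplexAnalysis.

Section Stratum.
Context {R : realType} (p a1 a2 : nat) (b : 'I_p -> nat).
Local Notation C := (cplx R).

(* A point [xi = (c, x)] stands for (CP^1, omega) written in an affine
   coordinate [u] in which z_1 = 0, z_2 = 1 and infinity is not a pole:
     omega = c u^a1 (u - 1)^a2 / prod_j (u - x_j)^(b_j) du.
   The relation a1 + a2 - sum_j b_j = -2 makes omega regular and nonzero at
   infinity.  Every one-form of the stratum has such coordinates, and two of
   them are related by a Moebius map fixing 0 and 1. *)
Definition form_coef (xi : C * 'rV[C]_p) (u : C) : C :=
  xi.1 * u ^+ a1 * (u - 1) ^+ a2 / \prod_(j < p) (u - xi.2 0 j) ^+ b j.

Definition stratum : set (C * 'rV[C]_p) :=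
  [set xi : C * 'rV[C]_p |
    [/\ xi.1 != 0, injective (fun j : 'I_p => xi.2 0 j) &
        forall j, xi.2 0 j != 0 /\ xi.2 0 j != 1]].

Definition biholomorphic (xi xi' : C * 'rV[C]_p) : Prop :=
  exists k l m n : C,
    let mob (u : C) : C := (k * u + l) / (m * u + n) in
    k * n - l * m != 0 /\
    [/\ n != 0 /\ mob 0 = 0, m + n != 0 /\ mob 1 = 1,
        forall j, m * xi.2 0 j + n != 0 /\ mob (xi.2 0 j) = xi'.2 0 j &
        forall u, m * u + n != 0 -> (forall j, u != xi.2 0 j) ->
          form_coef xi u
          = form_coef xi' (mob u) * ((k * n - l * m) / (m * u + n) ^+ 2)].

(* Residues are periods (no factor 1 / (2 i pi)). *)
Definition isoresidual_locus (lambda : 'rV[C]_p) : set (C * 'rV[C]_p) :=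
  [set xi : C * 'rV[C]_p | stratum xi /\
     forall j, \forall r \near (0 : R)^'+,
       path_integral (form_coef xi) (circle (xi.2 0 j) r) = lambda 0 j].

Definition joins_zeros (xi : C * 'rV[C]_p) (gamma : R -> C) : Prop :=
  [/\ C1_path gamma, gamma 0 = 0, gamma 1 = 1 &
      forall t, t \in `[0, 1] -> forall j, gamma t != xi.2 0 j].

End Stratum.

Section ResidueSpace.
Context (R : realType) (p : nat).
Local Notation C := (cplx R).

Definition residue_space : {vspace 'rV[C]_p} :=
  lker (linfun (fun lambda : 'rV[C]_p => \sum_(j < p) lambda 0 j : C)).

Lemma mem_residue_space (lambda : 'rV[C]_p) :
  (lambda \in residue_space) = (\sum_(j < p) lambda 0 j == 0).
Proof.
pose f (v : 'rV[C]_p) : C := \sum_(j < p) v 0 j.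
have lin_f : linear f.
  move=> k u v; rewrite /f scaler_sumr -big_split /=.
  by apply: eq_bigr => j _; rewrite !mxE.
pose HF := GRing.isLinear.Build _ _ _ _ f lin_f.
pose F : {linear 'rV[C]_p -> C} := HB.pack f HF.
by rewrite memv_ker -[linfun _]/(linfun F) lfunE.
Qed.

Definition regular_base : set 'rV[C]_p :=
  [set lambda : 'rV[C]_p | lambda \in residue_space /\
     forall I : {set 'I_p}, I != finset.set0 -> I != [set: 'I_p]%SET ->
       \sum_(i in I) lambda 0 i != 0].

Definition residue_dual : Type := 'Hom(subvs_of residue_space, C).

Definition dual_lattice : set residue_dual :=
  [set w : residue_dual | exists n : {set 'I_p} -> int, forall v : subvs_of residue_space,
     w v = \sum_(J : {set 'I_p}) (\sum_(j in J) vsval v 0 j) *~ n J].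

Definition eval_dual (w : residue_dual) (lambda : 'rV[C]_p) : C :=
  w (vsproj residue_space lambda).

End ResidueSpace.

Arguments regular_base : clear implicits.

Definition std_simplex (R : realType) (n : nat) : set 'rV[R]_n.+1 :=
  [set t : 'rV[R]_n.+1 | (forall i, 0 <= t 0 i) /\ \sum_(i < n.+1) t 0 i = 1].

Arguments std_simplex : clear implicits.

Section SingularHomology.
Context {R : realType}.
Local Notation Delta n := (set_type (std_simplex R n)).

Definition face_row n (i : 'I_n.+2) (t : 'rV[R]_n.+1) : 'rV[R]_n.+2 :=
  \row_k (if unlift i k is Some j then t 0 j else 0).

Lemma face_row_simplex n (i : 'I_n.+2) (t : Delta n) :
  face_row i (\val t) \in std_simplex R n.+1.
Proof.
case: t => t /set_mem /= [t0 t1]; apply/mem_set; split=> [k|].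
  by rewrite mxE; case: unlift.
rewrite (bigD1_ord i) //= mxE unlift_none add0r -t1.
by apply: eq_bigr => j _; rewrite mxE liftK.
Qed.

Definition face n (i : 'I_n.+2) (t : Delta n) : Delta n.+1 :=
  exist _ (face_row i (\val t)) (face_row_simplex i t).

Lemma vertex_simplex n (i : 'I_n.+1) :
  delta_mx 0 i \in std_simplex R n.
Proof.
apply/mem_set; split=> [k|]; first by rewrite mxE; case: (_ && _).
rewrite (bigD1 i) //= mxE !eqxx big1 ?addr0 // => k ki.
by rewrite mxE (negPf ki) andbF.
Qed.

Definition vertex n (i : 'I_n.+1) : Delta n :=
  exist _ (delta_mx 0 i) (vertex_simplex i).

Context {E : topologicalType}.

(* Finite support is required in [sing_chain]. *)
Definition chain (n : nat) : Type := (Delta n -> E) -> int.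

Definition sing_chain n (A : set E) : set (chain n) :=
  [set c | finite_set [set sigma : Delta n -> E | c sigma != 0] /\
     forall sigma, c sigma != 0 ->
       continuous sigma /\ forall t, A (sigma t)].

Definition boundary n (c : chain n.+1) : chain n :=
  fun tau => \sum_(sigma \in [set: Delta n.+1 -> E])
    \sum_(i < n.+2 | `[< sigma \o face i = tau >]) (-1) ^+ i * c sigma.

Definition push_chain n (f : E -> E) (c : chain n) : chain n :=
  fun tau => \sum_(sigma \in [set sigma : Delta n -> E | f \o sigma = tau]) c sigma.

Definition rel_cycle (A B : set E) : set (chain 1) :=
  [set c | sing_chain A c /\ sing_chain B (boundary c)].

Definition homologous (A B : set E) (c c' : chain 1) : Prop :=
  exists (d : chain 2) (e : chain 1),
    [/\ sing_chain A d, sing_chain B e &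
        forall sigma, c' sigma = c sigma + boundary d sigma + e sigma].

(* A relative homology class is the set of the relative cycles that
   represent it; [H1 A B] is the set of classes H_1(A, B; Z). *)
Definition hclass : Type := set (chain 1).

Definition class_of (A B : set E) (c : chain 1) : hclass :=
  [set c' | rel_cycle A B c' /\ homologous A B c c'].

Definition H1 (A B : set E) : set hclass :=
  [set gamma | exists2 c, rel_cycle A B c & gamma = class_of A B c].

(* The map induced by [f] on relative classes, with target H_1(A, B; Z). *)
Definition push_class (A B : set E) (f : E -> E) (gamma : hclass) : hclass :=
  [set c' | exists2 c, gamma c & class_of A B (push_chain f c) c'].

End SingularHomology.

Section Family.
Context {R : realType} {p : nat}.
Local Notation C := (cplx R).

(* The disjoint union, over the base, of the compactified isoresidual loci.
   [proj] is the residue vector; [cls] sends a one-form to its image in the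
   compactification; [atlas lambda] is a set of charts (U, phi) of the fiber
   over [lambda]; in the chart [c], the one-form omega_lambda is
   [coef lambda c z dz]. *)
Record family_data := FamilyData {
  total_space : topologicalType;
  proj : total_space -> 'rV[C]_p;
  cls : C * 'rV[C]_p -> total_space;
  atlas : 'rV[C]_p -> set (set total_space * (total_space -> C));
  coef : 'rV[C]_p -> set total_space * (total_space -> C) -> C -> C
}.

Variable M : family_data.
Implicit Types (lambda : 'rV[C]_p) (x : total_space M).

Definition fiber lambda : set (total_space M) := [set x | proj x = lambda].

Definition zero_set lambda : set (total_space M) :=
  [set x | fiber lambda x /\ exists c, [/\ atlas lambda c, c.1 x &
             zero_at (coef lambda c) (c.2 x)]].

Definition pole_set lambda : set (total_space M) :=
  [set x | fiber lambda x /\ exists c, [/\ atlas lambda c, c.1 x &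
             pole_at (coef lambda c) (c.2 x)]].

Definition is_chart lambda (c : set (total_space M) * (total_space M -> C)) : Prop :=
  [/\ exists2 O, open O & c.1 = O `&` fiber lambda,
      {within c.1, continuous c.2},
      set_inj c.1 c.2 &
      forall O, open O -> open (c.2 @` (O `&` c.1))].

Definition compatible lambda (c c' : set (total_space M) * (total_space M -> C)) : Prop :=
  forall x, c.1 x -> c'.1 x -> exists g : C -> C,
    [/\ holomorphic_at g (c.2 x),
        \forall y \near x, c.1 y -> c'.1 y -> c'.2 y = g (c.2 y) &
        \forall z \near (c.2 x)^',
          coef lambda c z = coef lambda c' (g z) * 'D_(1 : C) g z].

(* The fiber over [lambda] is a Riemann surface carrying the meromorphic
   one-form given by [coef lambda]. *)
Definition surface_with_form lambda : Prop :=
  [/\ forall c, atlas lambda c -> is_chart lambda c,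
      forall x, fiber lambda x -> exists2 c, atlas lambda c & c.1 x,
      forall c c', atlas lambda c -> atlas lambda c' -> compatible lambda c c' &
      forall c x, atlas lambda c -> c.1 x ->
        holomorphic_at (coef lambda c) (c.2 x) \/
        pole_at (coef lambda c) (c.2 x)].

(* A homeomorphism U x (fiber over [l0]) -> (part over U), compatible with the
   projection, the zero sets and the pole sets; [Phi'] is the second
   component of its inverse. *)
Definition trivialization (U : set 'rV[C]_p) (l0 : 'rV[C]_p)
    (Phi : 'rV[C]_p -> total_space M -> total_space M) (Phi' : total_space M -> total_space M) : Prop :=
  [/\ U `<=` regular_base R p,
      exists2 O, open O & U = O `&` regular_base R p,
      U l0,
      forall l x, U l -> fiber l0 x ->
        [/\ fiber l (Phi l x), Phi' (Phi l x) = x,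
            zero_set l (Phi l x) <-> zero_set l0 x &
            pole_set l (Phi l x) <-> pole_set l0 x] &
      [/\ forall y, U (proj y) -> fiber l0 (Phi' y) /\ Phi (proj y) (Phi' y) = y,
          {within [set lx | U lx.1 /\ fiber l0 lx.2],
            continuous (fun lx : 'rV[C]_p * total_space M => Phi lx.1 lx.2)} &
          {within [set y | U (proj y)], continuous Phi'}]].

(* The total space over the base of the closures of the isoresidual loci.
   The last-but-one clause says that omega_lambda = d (int_gamma omega) on
   the isoresidual locus: in a chart, the function int_gamma omega is a
   primitive of the coefficient.  In particular the charts are holomorphic for
   the complex structure of the locus, for which int_gamma omega is a local
   coordinate.  A compact Riemann surface containing this (punctured) surface
   as a dense open subset is unique, so these clauses determine the fibers. *)
Record is_isoresidual_family (a1 a2 : nat) (b : 'I_p -> nat) : Prop := {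
  family_hausdorff : hausdorff_space (total_space M);
  proj_continuous : continuous (@proj M);
  proj_base : forall x, regular_base R p (proj x);
  proj_cls : forall lambda xi, regular_base R p lambda ->
    isoresidual_locus a1 a2 b lambda xi -> proj (cls M xi) = lambda;
  cls_eq : forall lambda xi xi', regular_base R p lambda ->
    isoresidual_locus a1 a2 b lambda xi -> isoresidual_locus a1 a2 b lambda xi' ->
    (cls M xi = cls M xi' <-> biholomorphic a1 a2 b xi xi');
  cls_continuous :
    {within \bigcup_(lambda in regular_base R p) isoresidual_locus a1 a2 b lambda,
      continuous (cls M)};
  cls_open : forall O, open O ->
    open (cls M @` (O `&`
      \bigcup_(lambda in regular_base R p) isoresidual_locus a1 a2 b lambda));
  fiber_closure : forall lambda, regular_base R p lambda ->
    fiber lambda = closure (cls M @` isoresidual_locus a1 a2 b lambda);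
  fiber_compact : forall lambda, regular_base R p lambda ->
    compact (fiber lambda);
  fiber_surface : forall lambda, regular_base R p lambda ->
    surface_with_form lambda;
  form_is_d_period : forall lambda xi gamma c, regular_base R p lambda ->
    isoresidual_locus a1 a2 b lambda xi -> joins_zeros xi gamma ->
    atlas lambda c -> c.1 (cls M xi) ->
    exists F : C -> C,
      (\forall xi' \near xi, isoresidual_locus a1 a2 b lambda xi' ->
         F (c.2 (cls M xi')) = path_integral (form_coef a1 a2 b xi') gamma) /\
      (\forall z \near c.2 (cls M xi), is_derive z (1 : C) F (coef lambda c z));
  family_locally_trivial : forall lambda, regular_base R p lambda ->
    exists U Phi Phi', trivialization U lambda Phi Phi'
}.

Definition local_system lambda : set (@hclass R (total_space M)) :=
  H1 (fiber lambda `\` pole_set lambda) (zero_set lambda).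

(* Gauss-Manin transport from [H_l] to [H_l'] inside a trivialization. *)
Definition transport (Phi : 'rV[C]_p -> total_space M -> total_space M)
    (Phi' : total_space M -> total_space M) (l' : 'rV[C]_p)
    (gamma : @hclass R (total_space M)) : @hclass R (total_space M) :=
  push_class (fiber l' `\` pole_set l') (zero_set l') (Phi l' \o Phi') gamma.

Definition loop_in_base (alpha : R -> 'rV[C]_p) lambda : Prop :=
  [/\ {within `[0, 1], continuous alpha},
      forall t, t \in `[0, 1] -> regular_base R p (alpha t),
      alpha 0 = lambda & alpha 1 = lambda].

Definition flat_along (alpha : R -> 'rV[C]_p)
    (s : R -> @hclass R (total_space M)) : Prop :=
  forall t, t \in `[0, 1] -> local_system (alpha t) (s t) /\
    exists U l0 Phi Phi', [/\ trivialization U l0 Phi Phi', U (alpha t) &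
      \forall t' \near t, t' \in `[0, 1] ->
        s t' = transport Phi Phi' (alpha t') (s t)].

Definition is_monodromy (alpha : R -> 'rV[C]_p) lambda
    (T : @hclass R (total_space M) -> @hclass R (total_space M)) : Prop :=
  forall gamma, local_system lambda gamma ->
    exists s, [/\ flat_along alpha s, s 0 = gamma & s 1 = T gamma].

(* Integration of omega_lambda along a continuous path, by continuation of
   local primitives. *)
Definition simplex_integral lambda
    (sigma : set_type (std_simplex R 1) -> total_space M) : C :=
  get [set v | exists2 G : set_type (std_simplex R 1) -> C,
    (forall t, exists c F, [/\ atlas lambda c, c.1 (sigma t),
        \forall z \near c.2 (sigma t), is_derive z (1 : C) F (coef lambda c z) &
        \forall t' \near t, G t' = F (c.2 (sigma t'))]) &
    v = G (vertex ord_max) - G (vertex ord0)].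

Definition chain_integral lambda (c : @chain R (total_space M) 1) : C :=
  \sum_(sigma \in [set: set_type (std_simplex R 1) -> total_space M])
    simplex_integral lambda sigma *~ c sigma.

(* [Psi lambda gamma] is the element w of the lattice such that the period of
   omega_l' on the Gauss-Manin extension of [gamma] is w(l') for l' near
   [lambda]. *)
Definition is_period_central_charge
    (Psi : 'rV[C]_p -> @hclass R (total_space M) -> residue_dual R p) : Prop :=
  forall lambda gamma, regular_base R p lambda -> local_system lambda gamma ->
    dual_lattice (Psi lambda gamma) /\
    forall U l0 Phi Phi', trivialization U l0 Phi Phi' -> U lambda ->
      \forall l' \near within (regular_base R p) (nbhs lambda),
        forall c, transport Phi Phi' l' gamma c ->
          chain_integral l' c = eval_dual (Psi lambda gamma) l'.

End Family.

(* Main.v *)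
(* Transport a flat section s along alpha.  Inside one trivialization the
   transports compose, so the class transported from alpha(t) and the class
   transported from alpha(t') have a common representative over every fiber
   near alpha(t').  The linear forms Psi(alpha(t), s(t)) and
   Psi(alpha(t'), s(t')) both give the period of that representative, hence
   agree on a nonempty open subset of the residue space, hence are equal.  Thus
   t |-> Psi(alpha(t), s(t)) is locally constant on [0, 1], so it is constant. *)
Require Import Defs.
From mathcomp Require Import all_boot all_order all_algebra finmap.
From mathcomp Require Import all_classical all_reals all_analysis.
From mathcomp Require Import complex.

Set Implicit Arguments.
Unset Strict Implicit.
Unset Printing Implicit Defensive.

Import Order.TTheory GRing.Theory Num.Theory.
Import numFieldNormedType.Exports.

Local Open Scope classical_set_scope.
Local Open Scope ring_scope.

(** * Sums over an arbitrary type of functions with finite support *)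

Section FiniteSupportSums.
Variables X Y : choiceType.

Lemma fsumE (S : pzRingType) (A : {fset X}) (F : X -> S) :
  (forall x, F x <> 0 -> x \in A) ->
  \sum_(x \in [set: X]) F x = \sum_(x <- A) F x.
Proof.
move=> FA; apply: fsbigTE => x xA; apply: contrapT => /FA.
by rewrite (negPf xA).
Qed.

Lemma fsum_delta (g : X -> int) x :
  \sum_(y \in [set: X]) (x == y)%:R * g y = g x.
Proof.
rewrite (@fsumE _ [fset x]%fset) ?big_seq_fset1 ?eqxx ?mul1r// => y.
by rewrite inE eq_sym; case: eqP => //; rewrite mul0r.
Qed.

(** Push-forward and boundary both have the kernel form on the left, so this one Fubini argument
    serves both. The supports of the [K x] over the finitely many [x] with [c x != 0] have a finite
    union, hence both sums are finite. *)
Lemma fsum_exchange (c : X -> int) (K : X -> Y -> int) (g : Y -> int) :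
  finite_set [set x | c x != 0] ->
  (forall x, finite_set [set y | K x y != 0]) ->
  \sum_(y \in [set: Y]) (\sum_(x \in [set: X]) c x * K x y) * g y =
  \sum_(x \in [set: X]) c x * \sum_(y \in [set: Y]) K x y * g y.
Proof.
move=> fc fK.
have fB : finite_set (\bigcup_(x in [set x | c x != 0]) [set y | K x y != 0]).
  exact: bigcup_finite.
set A := fset_set [set x | c x != 0].
set B := fset_set (\bigcup_(x in [set x | c x != 0]) [set y | K x y != 0]).
have cA x : c x != 0 -> x \in A by move=> cx; rewrite in_fset_set// inE.
have KB x y : c x != 0 -> K x y != 0 -> y \in B.
  by move=> cx Kxy; rewrite in_fset_set// inE; exists x.
have inner y : \sum_(x \in [set: X]) c x * K x y = \sum_(x <- A) c x * K x y.
  by apply: fsumE => x /eqP; rewrite mulf_eq0 negb_or => /andP[/cA].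
rewrite (@fsbigTE _ _ _ _ B); last first.
  move=> y yB; rewrite fsbig1 ?mul0r// => x _; apply/eqP.
  apply: contraNT yB; rewrite mulf_eq0 negb_or => /andP[cx Kxy].
  exact: KB cx Kxy.
rewrite [RHS](@fsumE _ A); last first.
  by move=> x /eqP; rewrite mulf_eq0 negb_or => /andP[/cA].
under eq_bigr do rewrite inner mulr_suml.
rewrite exchange_big /=; apply: eq_bigr => x _.
(* [B] is known to contain the support of [K x] only when [c x] is nonzero; otherwise both sides
   vanish. *)
have [->|cx] := eqVneq (c x) 0.
  by rewrite mul0r big1 // => y _; rewrite !mul0r.
rewrite (@fsbigTE _ _ _ _ B) ?mulr_sumr; last first.
  move=> y yB; apply/eqP; apply: contraNT yB.
  by rewrite mulf_eq0 negb_or => /andP[/(KB _ _ cx)].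
by apply: eq_bigr => y _; rewrite mulrA.
Qed.

End FiniteSupportSums.

(** * Push-forward of singular chains and its compatibility with the boundary *)

Section PushForward.
Context {R : realType} {E : topologicalType}.
Local Notation Delta n := (set_type (std_simplex R n)).
Local Notation chain n := (@chain R E n).
Implicit Types (f g : E -> E).

Lemma push_chainE n f (c : chain n) tau :
  push_chain f c tau =
  \sum_(sigma \in [set: Delta n -> E]) c sigma * (f \o sigma == tau)%:R.
Proof.
rewrite /push_chain fsbig_mkcond; apply: eq_fsbigr => sigma _.
rewrite /patch; case: ifPn => [|/negP st].
  by rewrite inE /= => ->; rewrite eqxx mulr1.
by case: eqP => [ft|_]; [case: st; rewrite inE|rewrite mulr0].
Qed.

Lemma boundaryE n (c : chain n.+1) tau :
  boundary c tau = \sum_(sigma \in [set: Delta n.+1 -> E])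
    c sigma * \sum_(i < n.+2) (-1) ^+ i * (sigma \o face i == tau)%:R.
Proof.
apply: eq_fsbigr => sigma _; rewrite big_mkcond mulr_sumr.
apply: eq_bigr => i _; case: ifPn => [/asboolP ->|/asboolPn/eqP/negPf ->].
  by rewrite eqxx mulr1 mulrC.
by rewrite !mulr0.
Qed.

Lemma finite_delta (X : choiceType) (a : int) (x : X) :
  finite_set [set y | a * (x == y)%:R != 0].
Proof.
apply: (@sub_finite_set _ _ [set x]) => [y /=|]; last exact: finite_set1.
by case: (x =P y) => [-> //|_]; rewrite mulr0 eqxx.
Qed.

Lemma finite_face_sum n (sigma : Delta n.+1 -> E) :
  finite_set [set tau : Delta n -> E |
    \sum_(i < n.+2) (-1) ^+ i * (sigma \o face i == tau)%:R != 0 :> int].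
Proof.
apply: (@sub_finite_set _ _
  ((fun i : 'I_n.+2 => sigma \o face i) @` [set: 'I_n.+2])); last first.
  exact/finite_image/finite_finset.
move=> tau /=; apply: contra_neqP => ntau; rewrite big1 // => i _.
by case: eqP => [st|]; [case: ntau; exists i|rewrite mulr0].
Qed.

(** Change of variables: push-forward of chains is adjoint to pull-back of cochains. *)
Lemma fsum_push_chain n f (c : chain n) (h : (Delta n -> E) -> int) :
  finite_set [set sigma | c sigma != 0] ->
  \sum_(tau \in [set: Delta n -> E]) push_chain f c tau * h tau =
  \sum_(sigma \in [set: Delta n -> E]) c sigma * h (f \o sigma).
Proof.
move=> fc; under eq_fsbigr do rewrite push_chainE.
rewrite fsum_exchange //; last first.
  move=> sigma; have := finite_delta 1 (f \o sigma).
  by under eq_set do rewrite mul1r.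
by apply: eq_fsbigr => sigma _; rewrite fsum_delta.
Qed.

(** The inner sum on the right is the coboundary of [h], so this is the adjunction between boundary
    and coboundary. *)
Lemma fsum_boundary n (c : chain n.+1) (h : (Delta n -> E) -> int) :
  finite_set [set sigma | c sigma != 0] ->
  \sum_(tau \in [set: Delta n -> E]) boundary c tau * h tau =
  \sum_(sigma \in [set: Delta n.+1 -> E])
    c sigma * \sum_(i < n.+2) (-1) ^+ i * h (sigma \o face i).
Proof.
move=> fc; under eq_fsbigr do rewrite boundaryE.
rewrite fsum_exchange //; last exact: finite_face_sum.
apply: eq_fsbigr => sigma _; congr (_ * _).
under eq_fsbigr => tau do rewrite mulr_suml.
(* The faces of [sigma], possibly repeated, form a common finite support for all the delta
   functions, so the two sums can be exchanged. *)
rewrite (@fsumE _ _ [fset sigma \o face i | i in 'I_n.+2]%fset); last first.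
  move=> tau /eqP; apply: contra_neqT => ntau; rewrite big1 // => i _.
  case: eqP => [st|]; last by rewrite mulr0 mul0r.
  by case/imfsetP: ntau; exists i.
rewrite exchange_big; apply: eq_bigr => i _ /=.
rewrite -[h _](fsum_delta h) (@fsumE _ _ [fset sigma \o face i | i in 'I_n.+2]%fset).
  by rewrite mulr_sumr; apply: eq_bigr => tau _; rewrite mulrA.
move=> tau /eqP; case: (sigma \o face i =P tau) => [<- _|_]; last by rewrite mul0r eqxx.
by apply/imfsetP; exists i.
Qed.

Lemma push_chain_support n f (c : chain n) tau :
  push_chain f c tau != 0 -> exists2 sigma, c sigma != 0 & f \o sigma = tau.
Proof.
rewrite push_chainE; apply: contra_neqP => /forall2NP nf.
rewrite fsbig1 // => sigma _; apply/eqP; rewrite mulf_eq0.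
by case: (nf sigma) => [/negP/negPn/eqP ->|/eqP/negPf ->]; rewrite eqxx ?orbT.
Qed.

Lemma finite_push_chain n f (c : chain n) :
  finite_set [set sigma | c sigma != 0] ->
  finite_set [set tau | push_chain f c tau != 0].
Proof.
move=> fc; apply: (@sub_finite_set _ _
  ((fun sigma => f \o sigma) @` [set sigma | c sigma != 0])).
  by move=> tau /push_chain_support[sigma cs <-]; exists sigma.
exact: finite_image.
Qed.

Lemma push_chain_comp n f g (c : chain n) :
  finite_set [set sigma | c sigma != 0] ->
  push_chain g (push_chain f c) = push_chain (g \o f) c.
Proof.
move=> fc; apply/funext => tau; rewrite push_chainE push_chainE.
by rewrite (fsum_push_chain f (fun sigma => (g \o sigma == tau)%:R)).
Qed.

Lemma eq_push_chain n (A : set E) f g (c : chain n) :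
  sing_chain A c -> (forall x, A x -> f x = g x) ->
  push_chain f c = push_chain g c.
Proof.
move=> [_ cA] fg; apply/funext => tau; rewrite !push_chainE.
apply: eq_fsbigr => sigma _; have [->|/cA[_ sA]] := eqVneq (c sigma) 0.
  by rewrite !mul0r.
suff -> : f \o sigma = g \o sigma by [].
by apply/funext => t /=; apply: fg.
Qed.

(** By the two adjunctions, both sides pair [c] with the same kernel, because
    [(f \o sigma) \o face i] and [f \o (sigma \o face i)] are convertible. *)
Lemma boundary_push_chain n f (c : chain n.+1) :
  finite_set [set sigma | c sigma != 0] ->
  boundary (push_chain f c) = push_chain f (boundary c).
Proof.
move=> fc; apply/funext => tau; rewrite boundaryE push_chainE.
rewrite (fsum_boundary (fun sigma => (f \o sigma == tau)%:R)) //.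
exact: (fsum_push_chain f (fun sigma =>
  \sum_(i < n.+2) (-1) ^+ i * (sigma \o face i == tau)%:R)).
Qed.

(** Continuity of [f] on [D] alone suffices: the simplices of [c] take their values in [A], inside
    [D]. This matters since transition maps are continuous only on fibers. *)
Lemma sing_chain_push n f (D A A' : set E) (c : chain n) :
  {within D, continuous f} -> A `<=` D -> (forall x, A x -> A' (f x)) ->
  sing_chain A c -> sing_chain A' (push_chain f c).
Proof.
move=> /subspace_continuousP cf AD fA [fc cA]; split.
  exact: finite_push_chain.
move=> tau /push_chain_support[sigma /cA[cs sA] <-]; split=> [t|t]; last exact: fA.
apply: (@cvg_comp _ _ _ sigma f _ (within D (nbhs (sigma t)))); last exact/cf/AD.
move=> V /(cs t) sV; change (nbhs t (fun u => V (sigma u))).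
by apply: (@filterS _ (nbhs t)) sV => u; apply; apply: AD.
Qed.

Lemma rel_cycle_push f (D A B A' B' : set E) (c : chain 1) :
  {within D, continuous f} -> A `<=` D -> B `<=` D ->
  (forall x, A x -> A' (f x)) -> (forall x, B x -> B' (f x)) ->
  rel_cycle A B c -> rel_cycle A' B' (push_chain f c).
Proof.
move=> cf AD BD fA fB [cA cB]; split; first exact: (sing_chain_push cf AD fA).
rewrite boundary_push_chain; first exact: (sing_chain_push cf BD fB).
by case: cA.
Qed.

Lemma class_of_refl (A B : set E) (c : chain 1) :
  rel_cycle A B c -> class_of A B c c.
Proof.
move=> rc; split=> //.
have z n D : sing_chain D ((fun=> 0) : chain n).
  split=> [|s]; last by rewrite eqxx.
  by apply: sub_finite_set (finite_set0 _) => s /=.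
exists (fun=> 0), (fun=> 0); split=> // sigma.
rewrite boundaryE fsbig1 ?addr0 // => tau _.
by rewrite mul0r.
Qed.

End PushForward.

(** * Transition maps between fibers of one trivialization, and their action on cycles *)

Section GaussManinTransport.
Context {R : realType} {p : nat} {M : @family_data R p}.
Variables (U : set 'rV[cplx R]_p) (l0 : 'rV[cplx R]_p).
Variables (Phi : 'rV[cplx R]_p -> total_space M -> total_space M).
Variables (Phi' : total_space M -> total_space M).
Hypothesis tU : trivialization U l0 Phi Phi'.
Implicit Types (l : 'rV[cplx R]_p) (x : total_space M).

Lemma transition_fiber l l' x : U l -> U l' -> fiber l x ->
  fiber l' ((Phi l' \o Phi') x).
Proof.
case: tU => _ _ _ h [h' _ _] Ul Ul' lx.
have /h'[x0 _] : U (Defs.proj x) by rewrite lx.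
by case: (h l' _ Ul' x0).
Qed.

(** All transitions factor through the reference fiber over [l0], and [Phi'] undoes [Phi l'] there;
    this is the cocycle rule. *)
Lemma transition_comp l l' l'' x : U l -> U l' -> fiber l x ->
  (Phi l'' \o Phi') ((Phi l' \o Phi') x) = (Phi l'' \o Phi') x.
Proof.
case: tU => _ _ _ h [h' _ _] Ul Ul' lx.
have /h'[x0 _] : U (Defs.proj x) by rewrite lx.
by case: (h l' _ Ul' x0) => _ /= ->.
Qed.

Lemma transition_zero_set l l' x : U l -> U l' -> zero_set l x ->
  zero_set l' ((Phi l' \o Phi') x).
Proof.
case: tU => _ _ _ h [h' _ _] Ul Ul' zx; have [lx _] := zx.
have /h'[x0 xE] : U (Defs.proj x) by rewrite lx.
have [_ _ z' _] := h l' _ Ul' x0; have [_ _ z _] := h l _ Ul x0.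
by apply/z'/z; move: xE; rewrite lx => ->.
Qed.

Lemma transition_punctured l l' x : U l -> U l' -> (fiber l `\` pole_set l) x ->
  (fiber l' `\` pole_set l') ((Phi l' \o Phi') x).
Proof.
case: tU => _ _ _ h [h' _ _] Ul Ul' [lx plx].
have /h'[x0 xE] : U (Defs.proj x) by rewrite lx.
have [fl' _ _ p'] := h l' _ Ul' x0; have [_ _ _ pl] := h l _ Ul x0.
split; first exact: fl'.
rewrite lx in xE; rewrite xE in pl.
by move=> px; exact: (plx (pl.2 (p'.1 px))).
Qed.

(** Joint continuity of [Phi] is restricted to the slice at [l'] and composed with [Phi']. *)
Lemma transition_continuous l l' : U l -> U l' ->
  {within @fiber R p M l, continuous (Phi l' \o Phi')}.
Proof.
case: tU => _ _ _ h [h' /subspace_continuousP cPhi /subspace_continuousP cPhi'].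
move=> Ul Ul'; apply/subspace_continuousP => x lx.
have Ux : U (Defs.proj x) by rewrite lx.
have [x0 _] := h' _ Ux.
move=> V /(cPhi (l', Phi' x) (conj Ul' x0)) [[A B] /= [lA xB] AB].
have {}xB := cPhi' x Ux B xB.
change (nbhs x (fun y => fiber l y -> V (Phi l' (Phi' y)))).
apply: (@filterS _ (nbhs x)) xB => y yB ly.
have Uy : U (Defs.proj y) by rewrite ly.
apply: (AB (l', Phi' y)); first by split=> //=; [exact: nbhs_singleton|exact: yB].
by split=> //=; case: (h' _ Uy).
Qed.

Lemma rel_cycle_transition l l' (c : @chain R (total_space M) 1) :
  U l -> U l' -> rel_cycle (fiber l `\` pole_set l) (zero_set l) c ->
  rel_cycle (fiber l' `\` pole_set l') (zero_set l') (push_chain (Phi l' \o Phi') c).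
Proof.
move=> Ul Ul'; apply: (rel_cycle_push (transition_continuous Ul Ul')).
- by move=> x [].
- by move=> x [].
- by move=> x; apply: transition_punctured.
- by move=> x; apply: transition_zero_set.
Qed.

(* Psi controls the period of every representative of a transported class, so
   one common representative is enough; equality of the two classes is not
   needed. *)
Lemma transport_common l l' l'' (gamma : @hclass R (total_space M)) :
  U l -> U l' -> U l'' -> local_system l gamma ->
  (transport Phi Phi' l'' gamma `&`
   transport Phi Phi' l'' (transport Phi Phi' l' gamma)) !=set0.
Proof.
move=> Ul Ul' Ul'' [c rc ->].
have rc' := rel_cycle_transition Ul Ul' rc.
have rc'' := rel_cycle_transition Ul Ul'' rc.
(* The common representative is the direct push of [c]; by the cocycle rule, pushing [c] through the
   fiber over [l'] gives the same chain. *)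
exists (push_chain (Phi l'' \o Phi') c); split.
  by exists c; exact: class_of_refl.
exists (push_chain (Phi l' \o Phi') c).
  by exists c; exact: class_of_refl.
have [sc _] := rc; have [fc _] := sc.
rewrite push_chain_comp // (@eq_push_chain _ _ _ (fiber l `\` pole_set l) _ (Phi l'' \o Phi')) //.
  exact: class_of_refl.
by move=> x [lx _]; exact: (transition_comp l'' Ul Ul' lx).
Qed.

End GaussManinTransport.

(** * Linear forms on the residue space are determined near any regular point *)

Section ResidueDual.
Context {R : realType} {p : nat}.
Implicit Types (l v : 'rV[cplx R]_p) (w : residue_dual R p).

Lemma eval_dualD w l v : eval_dual w (l + v) = eval_dual w l + eval_dual w v.
Proof. by rewrite /eval_dual !linearD. Qed.

Lemma eval_dualZ w (k : cplx R) v : eval_dual w (k *: v) = k * eval_dual w v.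
Proof. by rewrite /eval_dual !linearZ. Qed.

Lemma line_cvg l v : (fun k : cplx R => l + k *: v) @ (0 : cplx R) --> l.
Proof.
have : {for (0 : cplx R), continuous (fun k : cplx R => l + k *: v)}.
  apply: continuousD; first exact: cst_continuous.
  exact: (@scalel_continuous _ 'rV[cplx R]_p v).
by rewrite /prop_for /continuous_at scale0r addr0.
Qed.

(** There are finitely many hyperplanes, and each defining sum is affine in [k] and nonzero at
    [k = 0]. *)
Lemma regular_base_line l v : regular_base R p l -> v \in residue_space R p ->
  \forall k \near (0 : cplx R), regular_base R p (l + k *: v).
Proof.
move=> [lS lreg] vS.
pose ok (I : {set 'I_p}) (k : cplx R) : Prop :=
  I != finset.set0 -> I != [set: 'I_p]%SET ->
  \sum_(i in I) (l + k *: v) 0 i != 0.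
have F0 : Filter (nbhs (0 : cplx R)) by exact: nbhs_filter.
have : \forall k \near (0 : cplx R), forall I, ok I k.
  apply: (@filter_forall _ _ ok _ F0) => I; rewrite /ok.
  have [->|I0] := eqVneq I finset.set0; first exact: nearW.
  have [->|I1] := eqVneq I [set: 'I_p]%SET; first exact: nearW.
  set sl := (\sum_(i in I) l 0 i : cplx R); set sv := (\sum_(i in I) v 0 i : cplx R).
  have cs : (fun k : cplx R => sl + k * sv) @ (0 : cplx R) --> sl + 0 * sv.
    by apply: cvgD; [exact: cvg_cst|apply: cvgMl; exact: cvg_id].
  have : \forall k \near (0 : cplx R), sl + k * sv != 0.
    by apply: (cvgr_neq0 _ cs); rewrite mul0r addr0; exact: lreg.
  apply: filterS => k + _ _; apply: contra_neq => <-.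
  rewrite /sl /sv mulr_sumr -big_split; apply: eq_bigr => i _.
  by rewrite !mxE.
apply: filterS => k lk; split; last exact: lk.
by rewrite memvD // memvZ.
Qed.

(** For each direction [v], the point [l + k *: v] stays regular for small [k]. Subtracting the
    common value at [l] and cancelling a nonzero [k] leaves equality at [v]. *)
Lemma eq_eval_dual_near l w w' : regular_base R p l ->
  (\forall l' \near within (regular_base R p) (nbhs l),
     eval_dual w l' = eval_dual w' l') -> w = w'.
Proof.
move=> rl eqw; apply/lfunP => v.
have vS : vsval v \in residue_space R p by exact: subvsP.
have wv u : eval_dual u (vsval v) = u v by rewrite /eval_dual vsvalK.
rewrite -!wv.
have F0 : Filter (nbhs (0 : cplx R)) by exact: nbhs_filter.
have near_line : \forall k \near (0 : cplx R),
    eval_dual w (l + k *: vsval v) = eval_dual w' (l + k *: vsval v).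
  have near_rb := regular_base_line rl vS.
  have := line_cvg (vsval v) eqw.
  by apply: filterS2 near_rb => k rk; apply.
have eql := nbhs_singleton near_line; rewrite scale0r addr0 in eql.
(* The claim does not depend on [k]; the punctured neighborhood only supplies a nonzero [k]. *)
have : \forall k \near (0 : cplx R)^', eval_dual w (vsval v) = eval_dual w' (vsval v).
  near=> k.
  have k0 : k != 0 by near: k; exact: nbhs_dnbhs_neq.
  apply: (mulfI k0); rewrite -!eval_dualZ; apply: (addrI (eval_dual w l)).
  rewrite -eval_dualD eql -eval_dualD.
  by near: k; apply: nbhs_dnbhs.
by move=> /filter_ex [].
Unshelve. all: by end_near.
Qed.

End ResidueDual.

(** * Locally constant maps on the unit interval *)

Lemma segment_locally_constant (R : realType) (T : Type) (F : R -> T) :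
  (forall t : R, t \in `[0, 1] ->
    \forall t' \near t, t' \in `[0, 1] -> F t' = F t) ->
  F 1 = F 0.
Proof.
move=> locF; pose B := [set t : R | t \in `[0, 1] /\ F t = F 0].
(* [W True] and [W False] are open sets of the line whose traces on the interval are [B] and its
   complement; so [B] is relatively open and closed, and connectedness gives [B] the whole
   interval. *)
pose W b := \bigcup_(t in [set t : R | t \in `[0, 1] /\ (F t = F 0 <-> b)])
  ([set t' : R | t' \in `[0, 1] -> F t' = F t]^°).
have oW b : open (W b) by apply: bigcup_open => t _; exact: open_interior.
have WE b t : t \in `[0, 1] -> W b t <-> (F t = F 0 <-> b).
  move=> t01; split=> [[t' [t'01 t'b] /interior_subset /(_ t01) ->] //|tb].
  exists t => //; exact: locF.
have BE : B = `[0, 1]%classic.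
  apply: (@segment_connected R 0 1).
  - by exists 0; split=> //; rewrite in_itv /= lexx ler01.
  - exists (W True) => //; apply/seteqP; split=> t [].
      by move=> t01 Ft; split => //; apply/(WE True).
    by move=> t01 /(WE True _ t01) [_ Ft]; split => //; exact: Ft.
  - exists (~` (W False)); first exact: open_closedC.
    apply/seteqP; split=> t [t01].
      by move=> Ft; split => // /(WE False _ t01) [/(_ Ft)].
    move=> nW; split=> //; apply: contrapT => nF; apply: nW.
    by apply/WE => //; split.
have : B 1 by rewrite BE /= in_itv /= lexx ler01.
by case.
Qed.

(** * Invariance of the period central charge along the loop *)

Theorem proposition7p3 (R : realType) (p a1 a2 : nat) (b : 'I_p -> nat)
    (p_ge2 : (2 <= p)%N) (a1_gt0 : (0 < a1)%N) (a2_gt0 : (0 < a2)%N)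
    (b_gt0 : forall j, (0 < b j)%N)
    (degree : (a1 + a2 + 2 = \sum_(j < p) b j)%N)
    (M : @family_data R p) (hM : is_isoresidual_family M a1 a2 b)
    (Psi : 'rV[cplx R]_p -> @hclass R (total_space M) -> residue_dual R p)
    (hPsi : is_period_central_charge Psi)
    (lambda : 'rV[cplx R]_p) (hlambda : regular_base R p lambda)
    (alpha : R -> 'rV[cplx R]_p) (halpha : loop_in_base alpha lambda)
    (T_alpha : @hclass R (total_space M) -> @hclass R (total_space M))
    (hT : is_monodromy alpha lambda T_alpha)
    (gamma : @hclass R (total_space M)) (hgamma : local_system lambda gamma) :
  Psi lambda (T_alpha gamma) = Psi lambda gamma.
Proof.
have [s [flat s0 s1]] := hT _ hgamma.
have [/subspace_continuousP calpha alphaB alpha0 alpha1] := halpha.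
suff : Psi (alpha 1) (s 1) = Psi (alpha 0) (s 0).
  by rewrite alpha0 alpha1 s0 s1.
apply: (segment_locally_constant (F := fun t => Psi (alpha t) (s t))) => t t01.
have [gt [U [l0 [Phi [Phi' [tU Ut st]]]]]] := flat t t01.
have [_ /(_ _ _ _ _ tU Ut) int_t] := hPsi _ _ (alphaB t t01) gt.
have [UB [V oV UE] _ _ _] := tU.
have near_V : \forall t' \near t, t' \in `[0, 1] -> V (alpha t').
  apply: (calpha t t01); apply: open_nbhs_nbhs; split=> //.
  by move: Ut; rewrite UE => -[].
(* Passing to the interior makes the period formula at [alpha t] hold on a whole neighborhood of
   each nearby [alpha t']. *)
have near_int := calpha t t01 _ (nbhs_interior int_t).
have {}near_int : \forall t' \near t, t' \in `[0, 1] ->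
    \forall l \near within (regular_base R p) (nbhs (alpha t')),
      forall c, transport Phi Phi' l (s t) c ->
        chain_integral l c = eval_dual (Psi (alpha t) (s t)) l.
  exact: near_int.
near=> t' => t'01.
have Vt' : V (alpha t') by move: t'01; near: t'.
have int_t' : \forall l \near within (regular_base R p) (nbhs (alpha t')),
      forall c, transport Phi Phi' l (s t) c ->
        chain_integral l c = eval_dual (Psi (alpha t) (s t)) l.
  by move: t'01; near: t'.
have stt' : s t' = transport Phi Phi' (alpha t') (s t).
  by move: t'01; near: t'.
have Ut' : U (alpha t') by rewrite UE; split=> //; exact: alphaB.
have [gt' _] := flat t' t'01.
(* The period formula at [alpha t'] is taken in the trivialization chosen at [t], so that both
   transports are built from the same [Phi] and [Phi']. *)
have [_ /(_ _ _ _ _ tU Ut')] := hPsi _ _ (alphaB t' t'01) gt'.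
move=> int_t''.
apply: (eq_eval_dual_near (alphaB t' t'01)).
have near_V' : nbhs (alpha t') V by exact: open_nbhs_nbhs.
apply: filterS3 near_V' int_t' int_t'' => l Vl int_l int_l' Bl.
have Ul : U l by rewrite UE.
(* The integral of the single chain [c] over the fiber at [l] computes both linear forms at [l]. *)
have [c [cl cl']] := transport_common tU Ut Ut' Ul gt.
by rewrite -(int_l Bl c cl) -(int_l' Bl c) // stt'.
Unshelve. all: by end_near.
Qed.
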